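(* Let $s,t$ be integers with $s=2^as'$ and $t=2^bt'$, where $a,b$ are positive integers, $s',t'$ are integers with $2\nmid s't'$, and $b=2a-1$. Let $(P_n)_{n\ge1}$ be the sequence of Lucas atoms associated with $(s,t)$. Then for each $n\ge 2$, \[ v_2(P_n)=\begin{cases} a & \text{if } n=2,\\ b+1+v_2(s'^2+t') & \text{if } n=4,\\ 2^{h-2}b+1 & \text{if } n=2^h \text{ for some integer } h\ge 3,\\ b\,\dfrac{\varphi(n)}{2} & \text{otherwise.}\end{cases} \]
   Context: Lucas atoms: for $n\ge 1$ let $\Phi_n(\alpha,\beta)=\prod_{1\le j\le n,\ \gcd(j,n)=1}(\alpha-\omega^j\beta)$, with $\omega$ a primitive $n$-th root of unity (the homogenization of the $n$-th cyclotomic polynomial). Put $P_1(s,t)=1$, and for $n\ge 2$ let $P_n(s,t)\in\mathbb Z[s,t]$ be the unique polynomial with $P_n(\alpha+\beta,-\alpha\beta)=\Phi_n(\alpha,\beta)$ as polynomials in the variables $\alpha,\beta$. For integers $s,t$, $P_n$ denotes the integer value $P_n(s,t)$. $v_2$ is the $2$-adic valuation, with $v_2(0)=+\infty$; $\varphi$ is Euler's totient function. *)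

(* Defs.v *)
From mathcomp Require Import all_boot all_order all_fingroup all_algebra all_field.
From mathcomp Require Import mpoly.

Set Implicit Arguments.
Unset Strict Implicit.
Unset Printing Implicit Defensive.

Import Order.TTheory GRing.Theory Num.Theory.
Local Open Scope ring_scope.

(* 'X_0 and 'X_1 play the roles of alpha and beta. *)
Definition cyclotomic2 (w : algC) (n : nat) : {mpoly algC[2]} :=
  \prod_(1 <= j < n.+1 | coprime j n) ('X_0 - w ^+ j *: 'X_1).

(* s := alpha + beta, t := - alpha * beta *)
Definition alpha_beta_subst : 2.-tuple {mpoly int[2]} :=
  [tuple 'X_0 + 'X_1; - ('X_0 * 'X_1)].

(* In P, 'X_0 and 'X_1 play the roles of s and t. The defining identity fails
   for n = 1, since alpha - beta is not symmetric, hence the convention P_1 = 1.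
   The value 1 at n = 0 is a filler: the sequence is indexed by n >= 1. *)
Definition is_lucas_atom (n : nat) (P : {mpoly int[2]}) : Prop :=
  if (n <= 1)%N then P = 1
  else forall w : algC, n.-primitive_root w ->
    map_mpoly intr (P \mPo alpha_beta_subst) = cyclotomic2 w n.

Lemma homogenize_prod (K A : comNzRingType) (f : {rmorphism K -> A}) (x y : A)
    (ws : seq K) :
  \prod_(w <- ws) (x - f w * y) =
  \sum_(i < (size ws).+1)
     f (\prod_(w <- ws) ('X - w%:P))`_i * (x ^+ i * y ^+ (size ws - i)).
Proof.
elim: ws => [|w ws IH].
  by rewrite big_ord_recl !big_nil big_ord0 coef1 rmorph1 !mul1r addr0.
rewrite !big_cons IH /=.
set p := \prod_(_ <- _) _; set d := size ws.
have hp : p`_d.+1 = 0.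
  by apply: nth_default; rewrite size_prod_XsubC.
rewrite mulrBl.
under [RHS]eq_bigr => i _.
  rewrite mulrBl coefB coefXM coefCM rmorphB mulrBl.
  over.
rewrite sumrB; congr (_ - _).
  rewrite [RHS]big_ord_recl /= rmorph0 mul0r add0r mulr_sumr.
  apply: eq_bigr => i _.
  rewrite /bump /= subSS exprS; set c := f _; set z := y ^+ _.
  by rewrite !mulrA [x * c]mulrC.
rewrite [RHS]big_ord_recr /= hp mulr0 rmorph0 mul0r addr0 mulr_sumr.
apply: eq_bigr => i _; rewrite (rmorphM f) (subSn (leq_ord i)) exprS.
set c := f _; set z := y ^+ _; set u := x ^+ _.
by rewrite -!mulrA; congr (_ * _); rewrite mulrCA; congr (_ * _); rewrite mulrCA.
Qed.

Lemma comp_mpolyA2 (R : comNzRingType) (p : {mpoly R[2]})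
    (q r : 2.-tuple {mpoly R[2]}) :
  p \mPo q \mPo r = p \mPo [tuple tnth q i \mPo r | i < 2].
Proof.
rewrite [p \mPo q]comp_mpolyE [RHS]comp_mpolyE linear_sum /=.
apply: eq_bigr => m _; rewrite linearZ /=; congr (_ *: _).
rewrite rmorph_prod /=; apply: eq_bigr => i _.
by rewrite rmorphXn /= tnth_mktuple.
Qed.

Lemma cyclotomic2E1 w n : (1 < n)%N ->
  cyclotomic2 w n = \prod_(1 <= k < n | coprime k n) ('X_0 - w ^+ k *: 'X_1).
Proof.
move=> n1; rewrite /cyclotomic2 [LHS]big_mkcond big_nat_recr ?(ltnW n1) //=.
by rewrite {2}/coprime gcdnn (gtn_eqF n1) mulr1 -big_mkcond.
Qed.

Lemma cyclotomic2E w n : (1 < n)%N ->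
  cyclotomic2 w n = \prod_(k < n | coprime k n) ('X_0 - w ^+ k *: 'X_1).
Proof.
move=> n1; rewrite cyclotomic2E1 //.
rewrite -(big_mkord (fun k => coprime k n) (fun k => 'X_0 - w ^+ k *: 'X_1)).
by rewrite [RHS]big_ltn_cond ?(ltnW n1) // {2}/coprime gcd0n (gtn_eqF n1).
Qed.

Definition int_cyclotomic2 (n : nat) : {mpoly int[2]} :=
  \sum_(i < (totient n).+1) ('Phi_n)`_i *: ('X_0 ^+ i * 'X_1 ^+ (totient n - i)).

Lemma map_int_cyclotomic2 w n : (1 < n)%N -> n.-primitive_root w ->
  map_mpoly intr (int_cyclotomic2 n) = cyclotomic2 w n.
Proof.
move=> n1 pw; rewrite cyclotomic2E // /int_cyclotomic2.
pose ws := [seq w ^+ k | k <- [seq k <- index_iota 0 n | coprime k n]].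
have hprod (T : comNzRingType) (F : algC -> T) :
    \prod_(k < n | coprime k n) F (w ^+ k) = \prod_(u <- ws) F u.
  by rewrite /ws big_map big_filter big_mkord.
rewrite (hprod _ (fun u => 'X_0 - u *: 'X_1)).
have hC : cyclotomic w n = \prod_(u <- ws) ('X - u%:P).
  by rewrite -(hprod _ (fun u => 'X - u%:P)).
have hs : size ws = totient n.
  apply: succn_inj; rewrite -(size_prod_XsubC _ id) -(size_cyclotomic w n) hC.
  by [].
under [RHS]eq_bigr do rewrite -mul_mpolyC.
rewrite (homogenize_prod (@mpolyC 2 algC)) hs rmorph_sum /=.
apply: eq_bigr => i _; rewrite -hC -(Cintr_Cyclotomic pw) coef_map /=.
rewrite map_mpolyZ mul_mpolyC; congr (_ *: _).
by rewrite rmorphM !rmorphXn /= !map_mpolyX.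
Qed.

Lemma msym_X (R : comNzRingType) (s : {perm 'I_2}) i : msym s ('X_i : {mpoly R[2]}) = 'X_(s i).
Proof. by rewrite /msym mmapX mmap1U. Qed.

Lemma coprimeB j n : (j <= n)%N -> coprime (n - j) n = coprime j n.
Proof.
by move/subnK <-; rewrite addnK /coprime gcdnDl gcdnDr gcdnC.
Qed.

Lemma cyclotomic2_sym w n : (1 < n)%N -> n.-primitive_root w ->
  cyclotomic2 w n \is symmetric.
Proof.
move=> n1 pw; apply/issymP => s.
have ord2 (i : 'I_2) : i = 0 \/ i = 1.
  by case: i => [[|[|//]] ?]; [left|right]; apply/val_inj.
have s01 : s 0 <> s 1 by move/perm_inj.
have [s0E|s0E] := ord2 (s 0); have [s1E|s1E] := ord2 (s 1);
  rewrite s0E s1E in s01 => //.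
  suff -> : s = 1%g by exact: msym1m.
  by apply/permP => i; rewrite perm1; case: (ord2 i) => ->.
pose c := \prod_(1 <= k < n | coprime k n) (- w ^+ k).
have wn j : (j <= n)%N -> w ^+ j * w ^+ (n - j) = 1.
  by move=> le_jn; rewrite -exprD subnKC // (prim_expr_order pw).
have hc : msym s (cyclotomic2 w n) = c *: cyclotomic2 w n.
  rewrite cyclotomic2E1 // rmorph_prod /=.
  rewrite [X in c *: X]big_nat_rev /= -mul_mpolyC /c rmorph_prod /=.
  rewrite [X in _ = _ * X]big_nat_cond [X in _ = _ * X](eq_bigl
    (fun k => (1 <= k < n)%N && coprime k n)); last first.
    move=> k; have [/andP[_ /ltnW le_kn]|//] := boolP (1 <= k < n)%N => /=.
    by rewrite add1n subSS coprimeB.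
  rewrite -big_nat_cond -big_split /= big_nat_cond [RHS]big_nat_cond.
  apply: eq_bigr => k /andP[/andP[_ /ltnW le_kn] _].
  rewrite rmorphB /= linearZ /= !msym_X s0E s1E add1n subSS.
  rewrite mul_mpolyC scalerBr scalerA mulNr wn // scaleN1r opprK scaleNr.
  by rewrite addrC.
suff c1 : c = 1 by rewrite hc c1 scale1r.
pose e : 'I_2 -> algC := fun=> 1.
have := congr1 (meval e) hc; rewrite mevalZ.
have -> : meval e (msym s (cyclotomic2 w n)) = meval e (cyclotomic2 w n).
  rewrite cyclotomic2E1 // !rmorph_prod /=; apply: eq_bigr => k _.
  by rewrite rmorphB /= linearZ /= !msym_X !mevalB !mevalZ !mevalXU.
move=> h; apply: (@mulIf _ (meval e (cyclotomic2 w n))); last by rewrite mul1r -h.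
rewrite cyclotomic2E1 // rmorph_prod /= big_nat_cond prodf_seq_neq0.
apply/allP => k _; apply/implyP => /andP[/andP[k0 kn] _].
rewrite mevalB mevalZ !mevalXU mulr1 subr_eq0 eq_sym -(prim_order_dvd pw).
by rewrite gtnNdvd.
Qed.

Lemma map_mpoly_inj : injective (map_mpoly intr : {mpoly int[2]} -> {mpoly algC[2]}).
Proof.
move=> p q /mpolyP h; apply/mpolyP => m; apply: (@intr_inj algC).
by have := h m; rewrite !mcoeff_map_mpoly.
Qed.

Lemma int_cyclotomic2_sym n : (1 < n)%N -> int_cyclotomic2 n \is symmetric.
Proof.
move=> n1; apply/issymP => s; apply: map_mpoly_inj.
have [w pw] := C_prim_root_exists (ltnW n1).
have /issymP /(_ s) := cyclotomic2_sym n1 pw.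
rewrite -(map_int_cyclotomic2 n1 pw) => h; rewrite -[RHS]h.
by apply/mpolyP => m; rewrite mcoeff_sym !mcoeff_map_mpoly mcoeff_sym.
Qed.

Definition neg_second : 2.-tuple {mpoly int[2]} := [tuple 'X_0; - 'X_1].

Lemma neg_secondK (p : {mpoly int[2]}) : p \mPo neg_second \mPo neg_second = p.
Proof.
rewrite comp_mpolyA2 -[RHS]comp_mpoly_id; congr (_ \mPo _).
apply: eq_from_tnth => i; rewrite !tnth_mktuple.
by case: i => [[|[|//]] hi]; rewrite /= ?raddfN /= comp_mpolyXU /= ?opprK;
  congr 'X_(_); apply/val_inj.
Qed.

Lemma neg_second_subst (p : {mpoly int[2]}) :
  p \mPo neg_second \mPo alpha_beta_subst = p \mPo [tuple mesym 2 int i.+1 | i < 2].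
Proof.
rewrite comp_mpolyA2; congr (_ \mPo _).
apply: eq_from_tnth => i; rewrite !tnth_mktuple.
case: i => [[|[|//]] hi] /=.
  by rewrite /tnth /= comp_mpolyXU /= mesym1E !big_ord_recl big_ord0 addr0.
rewrite /tnth /= raddfN /= comp_mpolyXU /= opprK mesymnnE.
by rewrite !big_ord_recl big_ord0 mulr1.
Qed.

Lemma lucas_atom_exists n : {P : {mpoly int[2]} | is_lucas_atom n P}.
Proof.
rewrite /is_lucas_atom; case: (leqP n 1) => [_|n1]; first by exists 1.
have [t [tE _]] := sym_fundamental (int_cyclotomic2_sym n1).
exists (t \mPo neg_second) => w pw.
by rewrite neg_second_subst tE (map_int_cyclotomic2 n1 pw).
Qed.

Lemma lucas_atom_uniq n P Q : is_lucas_atom n P -> is_lucas_atom n Q -> P = Q.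
Proof.
rewrite /is_lucas_atom; case: (leqP n 1) => [_ -> -> //|n1 hP hQ].
have [w pw] := C_prim_root_exists (ltnW n1).
have := hP w pw; rewrite -(hQ w pw) => /map_mpoly_inj.
rewrite -[P]neg_secondK -[Q]neg_secondK [in LHS]neg_second_subst neg_second_subst.
by move/msym_fundamental_un ->.
Qed.

(* lucas_atom does not compute; lucas_atomP and lucas_atom_uniq characterize it. *)
Definition lucas_atom (n : nat) : {mpoly int[2]} := sval (lucas_atom_exists n).

Lemma lucas_atomP n : is_lucas_atom n (lucas_atom n).
Proof. exact: svalP. Qed.

Definition lucas_atom_value (s t : int) (n : nat) : int :=
  (lucas_atom n).@[tnth [tuple s; t]].

(* 2-adic valuation; None stands for +oo. *)
Definition v2 (m : int) : option nat :=
  if m == 0 then None else Some (logn 2 `|m|%N).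

(* Main.v *)
Require Import Defs.
From mathcomp Require Import all_boot all_order all_algebra.
From mathcomp Require Import all_field mpoly.
From mathcomp Require Import ring zify.

Set Implicit Arguments.
Unset Strict Implicit.
Unset Printing Implicit Defensive.

Import GRing.Theory Num.Theory.
Local Open Scope ring_scope.

(* Let x, y be the complex roots of X^2 - s X - t, so that P_n is the product of
   x - w^k y over k coprime to n. Exchanging x and y does not change P_n, so
   P_n^2 is the product of
     (x - w^k y) (y - w^k x) = x y (1 + w^k)^2 - w^k (x + y)^2.
   Since x y = - 2^b t' and (x + y)^2 = s^2 = 2^(b+1) s'^2, each factor is 2^b
   times an algebraic integer congruent to t' (1 - w^k)^2 modulo 2, hence
   P_n^2 = 2^(b totient(n)) r with r = t'^totient(n) Phi_n(1)^2 modulo 2. If n is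
   not a power of 2, write n = 2^k m with m > 1 odd: Phi_n(1) divides the value m
   of (X^n - 1) / (X^(2^k) - 1) at 1, and r is odd.
   The powers of 2 follow from P_2 = s, P_4 = s^2 + 2 t and the recursion
   P_(2n) = P_n^2 - 2 t^(n/2) for n = 2^h >= 4. *)

(** * Atoms as products over the roots of a quadratic *)

Lemma meval_map_intr n (v : 'I_n -> int) (p : {mpoly int[n]}) :
  (map_mpoly intr p).@[fun i => (v i)%:~R] = (p.@[v])%:~R :> algC.
Proof.
rewrite [in RHS]mevalE !raddf_sum /=; apply: eq_bigr => m _.
rewrite mevalM mevalC mmap1_id mevalX rmorphM rmorph_prod /=.
by congr (_ * _); apply: eq_bigr => i _; rewrite rmorphXn.
Qed.

(** The defining identity is evaluated at [x] and [y], where [alpha_beta_subst] becomes [(s, t)].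
    The hypotheses are symmetric in [x] and [y], so the roots may be exchanged. *)
Lemma lucas_atom_value_roots (s t : int) (x y w : algC) n :
    (1 < n)%N -> n.-primitive_root w ->
    x + y = s%:~R -> x * y = - t%:~R ->
  (lucas_atom_value s t n)%:~R =
    \prod_(j < n | coprime j n) (x - w ^+ j * y).
Proof.
move=> n1 pw xyD xyM; have := lucas_atomP n.
rewrite /is_lucas_atom leqNgt n1 /= => /(_ w pw).
rewrite map_mpoly_comp; last exact: intr_inj.
pose v := tnth [tuple x; y] => /(congr1 (meval v)).
rewrite comp_mpoly_meval cyclotomic2E // rmorph_prod /=.
under [X in _ = X -> _]eq_bigr => j _ do
  rewrite mevalB mevalZ !mevalXU /v /=.
move=> <-; rewrite /lucas_atom_value -meval_map_intr.
apply: meval_eq => -[[|[|//]] hi]; rewrite !(tnth_nth 0) /=.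
  by rewrite rmorphD /= !map_mpolyX mevalD !mevalXU /v /= -xyD.
by rewrite rmorphN rmorphM /= !map_mpolyX mevalN mevalM !mevalXU /v /=
  [tnth _ _ * _]xyM opprK.
Qed.

Lemma quadratic_roots (s t : int) :
  exists x y : algC, x + y = s%:~R /\ x * y = - t%:~R.
Proof.
pose d : algC := sqrtC (s%:~R ^+ 2 + 4%:R * t%:~R).
have d2 : d ^+ 2 = s%:~R ^+ 2 + 4%:R * t%:~R by exact: sqrtCK.
exists ((s%:~R + d) / 2%:R), ((s%:~R - d) / 2%:R); split; first by field.
transitivity ((s%:~R ^+ 2 - d ^+ 2) / 4%:R); first by field.
by rewrite d2; field.
Qed.

(** * Valuations, and the atoms at powers of 2 *)

Lemma v2_exp2M k (m : int) : v2 (2 ^+ k * m) = omap (addn k) (v2 m).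
Proof.
rewrite /v2 mulf_eq0 expf_eq0 /= andbF /=; case: eqP => //= /eqP m0.
rewrite abszM abszX lognM ?expn_gt0 ?absz_gt0 //.
by rewrite (pfactorK k (isT : prime 2)).
Qed.

Lemma v2_odd (m : int) : ~~ (2 %| m)%Z -> v2 m = Some 0%N.
Proof.
rewrite /v2 => m2; case: eqP m2 => [->//|_ m2]; congr Some.
by apply/eqP; rewrite lognE /= -[(2 %| _)%N]/(2 %| m)%Z (negbTE m2) andbF.
Qed.

Lemma v2_exp2M_odd k (m : int) : ~~ (2 %| m)%Z -> v2 (2 ^+ k * m) = Some k.
Proof. by move/v2_odd => h; rewrite v2_exp2M h /= addn0. Qed.

(* The factors of index i and i + 2^(h-1) combine into x^2 - (w^2)^(2i+1) y^2. *)
Lemma prod_sub_odd_exp (R : comNzRingType) h (w x y : R) :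
  w ^+ (2 ^ h) = -1 ->
  \prod_(i < 2 ^ h) (x - w ^+ i.*2.+1 * y) = x ^+ (2 ^ h) + y ^+ (2 ^ h).
Proof.
elim: h w x y => [|h IH] w x y wh.
  by rewrite expn0 big_ord_recl big_ord0 -[w]expr1 wh mulr1 mulN1r opprK.
have {}IH := IH (w ^+ 2) (x ^+ 2) (y ^+ 2) _.
rewrite -!exprM -expnS in IH; rewrite -IH //.
rewrite -(big_mkord xpredT (fun i => x - w ^+ i.*2.+1 * y)) /=.
rewrite (big_cat_nat (n := 2 ^ h)) //=; last by rewrite leq_pexp2l.
rewrite -{2}[(2 ^ h)%N]add0n big_addn big_mkord expnS mul2n -addnn addnK.
rewrite big_mkord -big_split /=; apply: eq_bigr => i _.
have -> : (i + 2 ^ h).*2.+1 = (i.*2.+1 + 2 ^ h.+1)%N.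
  by rewrite doubleD addSn expnS mul2n.
rewrite exprD wh mulrN1 mulNr opprK -exprM mul2n.
by rewrite -[in w ^+ _.*2]muln2 exprM; ring.
Qed.

Lemma prod_nat_odd (R : comNzRingType) m (F : nat -> R) :
  \prod_(0 <= k < m.*2 | odd k) F k = \prod_(0 <= i < m) F i.*2.+1.
Proof.
elim: m => [|m IH]; first by rewrite !big_nil.
rewrite doubleS !(big_nat_recr m) //= -IH.
rewrite [LHS]big_mkcond !big_nat_recr //= odd_double -big_mkcond /=.
by rewrite mulr1.
Qed.

(** The indices coprime to a power of 2 are the odd ones, and half the order of a primitive root
    sends it to -1. *)
Lemma lucas_atom_value_exp2 (s t : int) (x y : algC) h :
    x + y = s%:~R -> x * y = - t%:~R ->
  (lucas_atom_value s t (2 ^ h.+1))%:~R = x ^+ (2 ^ h) + y ^+ (2 ^ h).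
Proof.
move=> xyD xyM; have n1 : (1 < 2 ^ h.+1)%N by rewrite -{1}(expn0 2) ltn_exp2l.
have [w pw] := C_prim_root_exists (ltnW n1).
have w1 : w ^+ (2 ^ h) = -1.
  have : w ^+ (2 ^ h) ^+ 2 == 1.
    by rewrite -exprM -expnSr (prim_expr_order pw).
  rewrite sqrf_eq1 -(prim_order_dvd pw) dvdn_Pexp2l // ltnn /=.
  by move/eqP.
rewrite (lucas_atom_value_roots n1 pw xyD xyM) -(prod_sub_odd_exp _ _ w1).
rewrite -(big_mkord xpredT (fun i => x - w ^+ i.*2.+1 * y)) /=.
rewrite -(prod_nat_odd _ (fun k => x - w ^+ k * y)) -mul2n -expnS big_mkord.
by apply: eq_bigl => k; rewrite coprime_pexpr ?coprimen2.
Qed.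

Lemma lucas_atom_value2 (s t : int) : lucas_atom_value s t 2 = s.
Proof.
have [x [y [xyD xyM]]] := quadratic_roots s t.
apply: (@intr_inj algC).
by rewrite (lucas_atom_value_exp2 0 xyD xyM) !expr1.
Qed.

Lemma lucas_atom_value4 (s t : int) :
  lucas_atom_value s t 4 = s ^+ 2 + 2 * t.
Proof.
have [x [y [xyD xyM]]] := quadratic_roots s t.
apply: (@intr_inj algC).
rewrite (lucas_atom_value_exp2 1 xyD xyM) rmorphD rmorphM rmorphXn /=.
by rewrite -xyD -[t%:~R]opprK -xyM; ring.
Qed.

(** Squaring the sum of powers of [x] and [y] leaves a cross term in [x * y = - t], whose sign
    vanishes because the exponent [2 ^ h.+1] is even. *)
Lemma lucas_atom_value_exp2S (s t : int) h :
  lucas_atom_value s t (2 ^ h.+3) =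
    lucas_atom_value s t (2 ^ h.+2) ^+ 2 - 2 * t ^+ (2 ^ h.+1).
Proof.
have [x [y [xyD xyM]]] := quadratic_roots s t.
apply: (@intr_inj algC).
rewrite rmorphB /= rmorphXn /= rmorphM /= rmorphXn /=.
rewrite !(lucas_atom_value_exp2 _ xyD xyM).
have -> : (t%:~R : algC) = - (x * y) by rewrite xyM opprK.
have -> : (- (x * y)) ^+ (2 ^ h.+1) = x ^+ (2 ^ h.+1) * y ^+ (2 ^ h.+1).
  by rewrite exprNn -signr_odd oddX /= mul1r exprMn.
by rewrite [(2 ^ h.+2)%N]expnSr !exprM; ring.
Qed.

(** * Parity of cyclotomic polynomials at 1 *)

Lemma dvdz_Cyclotomic1 d m : (0 < d)%N -> (1 < m)%N ->
  (('Phi_(d * m)%N).[1%R] %| m%:Z)%Z.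
Proof.
move=> d0 m1; set n := (d * m)%N.
have n0 : (0 < n)%N by rewrite muln_gt0 d0 ltnW.
have [Q] : exists Q, \prod_(e <- divisors n) 'Phi_e =
    ('X^d - 1) * ('Phi_n * Q) :> {poly int}.
  (* The divisors of [n] that divide [d] contribute ['X^d - 1]; [n] is among the others because
     [m > 1]. *)
  rewrite (bigID (fun e => e %| d)%N) /= -big_filter.
  have -> : \prod_(e <- [seq e <- divisors n | (e %| d)%N]) 'Phi_e
      = 'X^d - 1 :> {poly int}.
    rewrite -prod_Cyclotomic //; apply: perm_big; apply: uniq_perm.
    - by rewrite filter_uniq ?divisors_uniq.
    - exact: divisors_uniq.
    move=> e; rewrite mem_filter -!dvdn_divisors //.
    by have [ed|//] := boolP (e %| d)%N; rewrite (dvdn_trans ed) ?dvdn_mulr.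
  rewrite (big_rem n) -?dvdn_divisors //=.
  by rewrite gtnNdvd ?ltn_Pmulr //=; eexists.
rewrite prod_Cyclotomic // {1}/n exprM -[X in _ - X](expr1n _ m) subrXX.
have Xd1 : 'X^d - 1 != 0 :> {poly int} by rewrite monic_neq0 ?monicXnsubC.
(* After cancelling ['X^d - 1], the left side is a geometric sum of [m] terms, each equal to 1 at
   1. *)
move/(mulfI Xd1)/(congr1 (fun p => p.[1])).
rewrite hornerM horner_sum => E; apply/dvdzP; exists Q.[1].
rewrite mulrC -E (eq_bigr (fun=> 1)) => [|i _].
  by rewrite sumr_const card_ord natz.
by rewrite expr1n mulr1 -exprM hornerXn expr1n.
Qed.

Lemma odd_Cyclotomic1 n : (0 < n)%N -> (forall h, n <> (2 ^ h)%N) ->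
  ~~ (2 %| ('Phi_n).[1%R])%Z.
Proof.
move=> n0 n2; have [m m2 nE] := pfactor_coprime (isT : prime 2) n0.
rewrite coprime2n in m2.
have m1 : (1 < m)%N.
  by case: m m2 nE => [|[|//]] // _; rewrite mul1n => /n2.
apply: contraL m2 => even; have : (2 %| m%:Z)%Z.
  apply: dvdz_trans even _; rewrite nE mulnC.
  by apply: dvdz_Cyclotomic1 => //; rewrite expn_gt0.
by rewrite -[(_ %| _)%Z]/(2 %| m)%N dvdn2.
Qed.

Lemma Cyclotomic1_prod (w : algC) n : n.-primitive_root w ->
  (('Phi_n).[1%R])%:~R = \prod_(k < n | coprime k n) (1 - w ^+ k).
Proof.
move=> pw; have := congr1 (fun p => p.[1]) (Cintr_Cyclotomic pw).
rewrite -[X in _.[X]](rmorph1 (intr : int -> algC)) horner_map /= => ->.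
rewrite horner_prod; apply: eq_bigr => k _.
by rewrite hornerXsubC.
Qed.

Lemma card_coprime_ord n : #|[pred k : 'I_n | coprime k n]| = totient n.
Proof.
rewrite totient_count_coprime big_mkord -sum1_card big_mkcond /=.
by apply: eq_bigr => k _; rewrite inE coprime_sym; case: coprime.
Qed.

(** * Congruences modulo 2 and the square of an atom *)

Lemma prod_sub2_Aint (I : finType) (P : pred I) (A B : I -> algC) :
    (forall i, A i \in Aint) -> (forall i, B i \in Aint) ->
  exists2 q, q \in Aint &
    \prod_(i | P i) (A i - 2 * B i) = \prod_(i | P i) A i + 2 * q.
Proof.
move=> ZA ZB.
(* The invariant also records that [y] is integral, which keeps the cross terms [y1 * q2] and
   [q1 * y2] integral. *)
pose K (x y : algC) := y \in Aint /\ exists2 q, q \in Aint & x = y + 2 * q.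
suff [] : K (\prod_(i | P i) (A i - 2 * B i)) (\prod_(i | P i) A i) by [].
apply: (big_ind2 K) => [|x1 y1 x2 y2 [Zy1 [q1 Zq1 ->]] [Zy2 [q2 Zq2 ->]]|i _].
- by split; [exact: Aint1 | exists 0; rewrite ?Aint0 // mulr0 addr0].
- split; first exact: rpredM.
  exists (y1 * q2 + q1 * y2 + 2 * (q1 * q2)); last by ring.
  by rewrite !rpredD ?rpredM ?rpred_nat.
- split; first exact: ZA.
  by exists (- B i); rewrite ?rpredN // mulrN.
Qed.

Lemma oddzM (m n : int) :
  ~~ (2 %| m)%Z -> ~~ (2 %| n)%Z -> ~~ (2 %| m * n)%Z.
Proof. by rewrite !dvdzE abszM Euclid_dvdM // negb_or => -> ->. Qed.

Lemma oddzX (m : int) k : ~~ (2 %| m)%Z -> ~~ (2 %| m ^+ k)%Z.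
Proof. by move=> m2; elim: k => [//|k IH]; rewrite exprS oddzM. Qed.

Lemma oddzD2 (m k : int) : ~~ (2 %| m)%Z -> ~~ (2 %| m + 2 * k)%Z.
Proof. lia. Qed.

Lemma lucas_atom_value_sqr (s t u t' : int) b n :
    (1 < n)%N -> s ^+ 2 = 2 ^+ b * (2 * u) -> t = 2 ^+ b * t' ->
    ~~ (2 %| t')%Z -> ~~ (2 %| ('Phi_n).[1%R])%Z ->
  exists2 r : int, ~~ (2 %| r)%Z &
    lucas_atom_value s t n ^+ 2 = 2 ^+ (b * totient n) * r.
Proof.
move=> n1 s2E tE t'2 Phi2; set P := lucas_atom_value s t n.
have [x [y [xyD xyM]]] := quadratic_roots s t.
have [w pw] := C_prim_root_exists (ltnW n1).
have Zw k : w ^+ k \in Aint by rewrite rpredX // (Aint_prim_root pw).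
(* Each paired factor is [2 ^+ b * (A k - 2 * B k)], since -(1 + z)^2 = (1 - z)^2 - 2 (1 + z^2) with
   z = [w ^+ k]. *)
pose A (k : 'I_n) := t'%:~R * (1 - w ^+ k) ^+ 2.
pose B (k : 'I_n) := w ^+ k * u%:~R + t'%:~R * (1 + (w ^+ k) ^+ 2).
have [k|k|q Zq qE] := @prod_sub2_Aint _ (fun k : 'I_n => coprime k n) A B.
- by rewrite /A rpredM ?Aint_int ?rpredX // rpredB ?Aint1.
- by rewrite /B rpredD ?rpredM ?rpredD ?Aint1 ?Aint_int ?rpredX ?(Aint_prim_root pw).
pose c : int := t' ^+ totient n * ('Phi_n).[1] ^+ 2.
have AE : \prod_(k < n | coprime k n) A k = c%:~R.
  rewrite /A big_split prodr_const card_coprime_ord prodrXl /=.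
  rewrite -Cyclotomic1_prod //.
  by rewrite /c rmorphM !rmorphXn.
have P2E : (P%:~R : algC) ^+ 2 = 2 ^+ (b * totient n) * (c%:~R + 2 * q).
  rewrite expr2 {1}(lucas_atom_value_roots n1 pw xyD xyM).
  rewrite (lucas_atom_value_roots n1 pw (etrans (addrC y x) xyD)
    (etrans (mulrC y x) xyM)) -big_split -AE -qE exprM -card_coprime_ord.
  rewrite -prodr_const -big_split /=; apply: eq_bigr => k _.
  transitivity (x * y * (1 + w ^+ k) ^+ 2 - w ^+ k * (x + y) ^+ 2); first ring.
  rewrite xyD xyM -(rmorphXn (intr : int -> algC)) /= s2E tE.
  rewrite !rmorphM !rmorphXn /=.
  by rewrite /A /B; ring.
(* Solving [P2E] for [q] shows that it is rational; being also an algebraic integer, it is an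
   integer. *)
have Qq : q \in Crat.
  have -> : q = (P%:~R ^+ 2 / 2 ^+ (b * totient n) - c%:~R) / 2.
    by rewrite P2E; field; rewrite expf_neq0 ?pnatr_eq0.
  by rewrite rpred_div ?rpredB ?rpred_div ?rpredX ?rpred_int ?rpred_nat.
have /intrP[k qk] := Cint_rat_Aint Qq Zq.
exists (c + 2 * k); last first.
  apply: (@intr_inj algC); rewrite rmorphXn /= P2E qk.
  by clearbody c; rewrite rmorphM rmorphXn /= intrD intrM.
by apply: oddzD2; apply: oddzM; apply: oddzX.
Qed.

(** At [h = 0] the cofactor is [u + t'], of unknown parity, so oddness is claimed only for [h > 0].
    There the recursion gives twice a square minus a power of [t'], odd whatever the previous
    cofactor was. *)
Lemma lucas_atom_value_exp2_factor (s t u t' : int) b h :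
    s ^+ 2 = 2 ^+ b * (2 * u) -> t = 2 ^+ b * t' -> ~~ (2 %| t')%Z ->
  exists2 r : int, (0 < h)%N -> ~~ (2 %| r)%Z &
    lucas_atom_value s t (2 ^ h.+2) = 2 ^+ (2 ^ h * b + 1) * r.
Proof.
move=> s2E tE t'2; elim: h => [|h [r _ IH]].
  exists (u + t') => //.
  by rewrite lucas_atom_value4 s2E tE exprD expn0 mul1n; ring.
exists (- t' ^+ (2 ^ h.+1) + 2 * r ^+ 2).
  by move=> _; apply: oddzD2; rewrite rpredN; apply: oddzX.
rewrite lucas_atom_value_exp2S IH tE !exprMn -!exprM.
have -> : (2 ^ h.+1 * b = 2 ^ h * b * 2)%N by rewrite expnS; lia.
have -> : (b * 2 ^ h.+1 = 2 ^ h * b * 2)%N by rewrite expnS; lia.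
move: (2 ^ h.+1)%N (2 ^ h * b)%N => k e; rewrite mulnDl !exprD.
by move: (2 ^+ (e * 2)) (t' ^+ k) => c d; ring.
Qed.

Theorem theorem19 (s t s' t' : int) (a b : nat)
    (ha : (0 < a)%N) (hb : (0 < b)%N)
    (hs : s = 2 ^+ a * s') (ht : t = 2 ^+ b * t')
    (hodd : ~~ (2 %| s' * t')%Z)
    (hab : b = (2 * a - 1)%N)
    (n : nat) (hn : (2 <= n)%N) :
  [/\ n = 2%N -> v2 (lucas_atom_value s t n) = Some a,
      n = 4%N ->
        v2 (lucas_atom_value s t n) =
        omap (fun e => b + 1 + e)%N (v2 (s' ^+ 2 + t')),
      forall h : nat, (3 <= h)%N -> n = (2 ^ h)%N ->
        v2 (lucas_atom_value s t n) = Some (2 ^ (h - 2) * b + 1)%N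
    & n <> 2%N -> n <> 4%N -> (forall h : nat, (3 <= h)%N -> n <> (2 ^ h)%N) ->
        v2 (lucas_atom_value s t n) = Some (b * (totient n %/ 2))%N].
Proof.
have s'2 : ~~ (2 %| s')%Z by apply: contra hodd; apply: dvdz_mulr.
have t'2 : ~~ (2 %| t')%Z by apply: contra hodd; apply: dvdz_mull.
(* The relation between [a] and [b] enters here as [2 * a = b + 1]. *)
have s2E : s ^+ 2 = 2 ^+ b * (2 * s' ^+ 2).
  rewrite hs exprMn -exprM mulrA -exprSr; congr (2 ^+ _ * _); lia.
split=> [->|->|[|[|[|h]]] // _ ->|n2 n4 n8].
- by rewrite lucas_atom_value2 hs v2_exp2M_odd.
- rewrite lucas_atom_value4 -v2_exp2M s2E ht exprD; congr v2; ring.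
- have [r /(_ isT) r2 ->] := lucas_atom_value_exp2_factor h.+1 s2E ht t'2.
  by rewrite v2_exp2M_odd.
have Phi2 : ~~ (2 %| ('Phi_n).[1%R])%Z.
  apply: odd_Cyclotomic1 => [|[|[|[|h]]] nE]; last exact: (n8 h.+3).
  - exact: ltnW.
  - by rewrite nE in hn.
  - exact: n2.
  - exact: n4.
have [r r2] := lucas_atom_value_sqr hn s2E ht t'2 Phi2.
set P := lucas_atom_value s t n => P2E.
(* A zero value would force [r = 0], which is even. *)
have P0 : P != 0.
  apply: contraNneq r2 => P0; move/eqP: P2E.
  by rewrite P0 expr0n eq_sym mulf_eq0 expf_eq0 andbF => /eqP->.
have := congr1 v2 P2E; rewrite v2_exp2M_odd // /v2 expf_eq0 (negbTE P0) /=.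
rewrite abszX lognX => -[PE]; congr Some.
(* By [PE] the product [b * totient n] is even, while [b = 2 * a - 1] is odd. *)
have f2 : (2 %| totient n)%N.
  rewrite -(@Gauss_dvdr _ b) -?PE ?dvdn_mulr // coprime2n hab; lia.
by rewrite muln_divA // -PE mulKn.
Qed.
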